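(* Let $N$ be a reduced Nordstrom–Robinson code with coset decomposition $N=\mathrm{Ker}(N)\cup\bigcup_{i=1}^{7}(a_i+\mathrm{Ker}(N))$, and let $H_{16}$ be an extended Hamming code of length 16 containing $N$. Then for every Fano plane $S$ on the point set $\{1,\ldots,7\}$ (regarded as its set of seven lines), the codes $N$ and $a_i+a_j+a_k+N$ for $\{i,j,k\}\in S$ form a partition of $H_{16}$ into Nordstrom–Robinson codes, $$H_{16}=N\cup\bigcup_{\{i,j,k\}\in S}(a_i+a_j+a_k+N),$$ and there are no other partitions of $H_{16}$ into Nordstrom–Robinson codes that contain $N$ as one of the parts (i.e. every such partition arises in this way from some Fano plane $S$ on $\{1,\ldots,7\}$).
   Context: $F_2^{n}$ is the vector space of dimension $n$ over the two-element field, with the Hamming distance. A binary code is a subset of $F_2^n$; it is reduced if it contains the zero vector. A Nordstrom–Robinson code is any binary code of length 16 with 256 codewords and minimum distance 6. An extended Hamming code of length 16 is a linear binary code of length 16, dimension 11 and minimum distance 4 (equivalently, up to a coordinate permutation, the Reed–Muller code $RM(2,4)$). The kernel of a code $C$ is $\mathrm{Ker}(C)=\{x\in F_2^n: x+C=C\}$. The kernel of a reduced Nordstrom–Robinson code $N$ is a linear code of dimension 5, so $N$ is the disjoint union of $\mathrm{Ker}(N)$ and seven further distinct cosets $a_i+\mathrm{Ker}(N)$, $i=1,\ldots,7$. A Fano plane on $\{1,\ldots,7\}$ is a set of seven 3-element subsets (lines) of $\{1,\ldots,7\}$ such that every pair of distinct points lies in exactly one line. *)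

(* Defs.v *)
From mathcomp Require Import all_boot all_algebra.
Set Implicit Arguments.
Unset Strict Implicit.
Unset Printing Implicit Defensive.

Import GRing.Theory.
Local Open Scope ring_scope.

Notation F2vec n := 'rV['F_2]_n.

Definition hamming_dist n (x y : F2vec n) : nat :=
  #|[set i : 'I_n | x 0 i != y 0 i]|.

Definition min_distance n (C : {set F2vec n}) (d : nat) : Prop :=
  (forall x y, x \in C -> y \in C -> x != y -> (d <= hamming_dist x y)%N) /\
  (exists x y, [/\ x \in C, y \in C, x != y & hamming_dist x y = d]).

Definition reduced n (C : {set F2vec n}) : Prop := 0 \in C.

Definition translate n (x : F2vec n) (C : {set F2vec n}) : {set F2vec n} :=
  [set x + c | c in C].

Definition Ker n (C : {set F2vec n}) : {set F2vec n} :=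
  [set x | translate x C == C].

Definition nordstrom_robinson (C : {set F2vec 16}) : Prop :=
  #|C| = 256%N /\ min_distance C 6.

Definition extended_hamming16 (H : {set F2vec 16}) : Prop :=
  exists V : {vspace F2vec 16},
    [/\ H = [set x in V], \dim V = 11%N & min_distance H 4].

Definition coset_decomposition (N : {set F2vec 16})
    (a : 'I_7 -> F2vec 16) : Prop :=
  [/\ N = Ker N :|: \bigcup_(i < 7) translate (a i) (Ker N),
      forall i, translate (a i) (Ker N) <> Ker N
    & injective (fun i => translate (a i) (Ker N))].

(* The point set {1,...,7} is rendered as 'I_7 = {0,...,6}. *)
Definition fano_plane (S : {set {set 'I_7}}) : Prop :=
  [/\ #|S| = 7%N,
      forall L, L \in S -> #|L| = 3%N
    & forall i j : 'I_7, i != j ->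
        exists! L : {set 'I_7}, [/\ L \in S, i \in L & j \in L]].

(* For a line L = {i,j,k}, this is a_i + a_j + a_k + N. *)
Definition line_translate (N : {set F2vec 16}) (a : 'I_7 -> F2vec 16)
    (L : {set 'I_7}) : {set F2vec 16} :=
  translate (\sum_(i in L) a i) N.

Definition fano_parts (N : {set F2vec 16}) (a : 'I_7 -> F2vec 16)
    (S : {set {set 'I_7}}) : {set {set F2vec 16}} :=
  N |: [set line_translate N a L | L in S].

Definition NR_partition (P : {set {set F2vec 16}}) (H : {set F2vec 16}) : Prop :=
  partition P H /\ (forall C, C \in P -> nordstrom_robinson C).

(* Main.v *)
Require Import Defs.
From mathcomp Require Import all_boot all_order all_algebra all_field.
From mathcomp Require Import zify ring.
Set Implicit Arguments.
Unset Strict Implicit.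
Unset Printing Implicit Defensive.

Import Order.TTheory GRing.Theory Num.Theory.
Local Open Scope ring_scope.

(* Let K be the dual of H. Power moments of s(k) = 16 - 2 wt(k) over K show that
   K contains the all-one word and that all its weights are 0, 8 or 16. For a
   Nordstrom-Robinson code C in H, a linear programming bound of degree 5 is
   tight, so the character sums of C vanish on all words of weight 1 to 5; as
   every coset of K outside H contains such a word, they vanish outside H, that
   is, C is a union of cosets of K.

   On H/K = F_2^6 the parity q of wt/2 is a quadratic form with polar form the
   dot product, and the Nordstrom-Robinson codes in H are the sets of eight
   cosets with pairwise q = 1. The Gram matrix of a_1, ..., a_7 is J - I, hence
   their only linear relation modulo K is a_1 + ... + a_7 = 0. Identifying H/K
   with the even subsets of {0, 1, ..., 7} modulo complement, where a_i is the
   pair {0, i}, words with q = 1 become pairs and a set of eight cosets as above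
   becomes a star, that is, a translate of N. The translates disjoint from N are
   those by 4-subsets {0, i, j, k}, and two of them are disjoint exactly when the
   triples meet in one point. *)

(** * Signs, characters and Hamming weights over the two-element field *)

Lemma F2_cases (b : 'F_2) : b = 0 \/ b = 1.
Proof. by case: b => [[|[|//]]] ?; [left | right]; apply: val_inj. Qed.

(** Integer values make character sums available to order arguments and to [lia]. *)
Definition sgn (b : 'F_2) : int := (-1) ^+ (b != 0).

Lemma sgnD : {morph sgn : b c / b + c >-> b * c}.
Proof.
by move=> b c; case: (F2_cases b) => ->; case: (F2_cases c) => ->.
Qed.

Lemma sgn_sum (I : finType) (F : I -> 'F_2) :
  sgn (\sum_i F i) = \prod_i sgn (F i).
Proof. exact: (big_morph sgn sgnD). Qed.

Section Characters.

Variable n : nat.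
Implicit Types (u x y : F2vec n) (G : {set F2vec n}).

Definition dot u x : 'F_2 := \sum_i u 0 i * x 0 i.

Lemma dotC u x : dot u x = dot x u.
Proof. by apply: eq_bigr => i _; rewrite mulrC. Qed.

Lemma dotDl u x y : dot (u + x) y = dot u y + dot x y.
Proof. by rewrite -big_split; apply: eq_bigr => i _; rewrite mxE mulrDl. Qed.

Lemma dotDr u x y : dot u (x + y) = dot u x + dot u y.
Proof. by rewrite dotC dotDl !(dotC _ u). Qed.

Lemma dot0l x : dot 0 x = 0.
Proof. by rewrite /dot big1 // => i _; rewrite mxE mul0r. Qed.

Lemma dot_delta i x : dot (delta_mx 0 i) x = x 0 i.
Proof.
rewrite /dot (bigD1 i) //= big1 => [|j /negbTE ji]; rewrite !mxE ?ji ?mul0r //.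
by rewrite !eqxx mul1r addr0.
Qed.

Lemma addvv x : x + x = 0.
Proof.
by apply/rowP => i; rewrite !mxE; case: (F2_cases (x 0 i)) => ->; apply: val_inj.
Qed.

Lemma addv_eq0 x y : (x + y == 0) = (x == y).
Proof. by rewrite -[in LHS](addvv y) (inj_eq (addIr y)). Qed.

Lemma addvK x y : x + y + y = x.
Proof. by rewrite -addrA addvv addr0. Qed.

Definition chi u x : int := sgn (dot u x).

Lemma chiDl u x y : chi (u + x) y = chi u y * chi x y.
Proof. by rewrite /chi dotDl sgnD. Qed.

Lemma chiDr u x y : chi u (x + y) = chi u x * chi u y.
Proof. by rewrite /chi dotDr sgnD. Qed.

Lemma chi_delta i x : chi (delta_mx 0 i) x = sgn (x 0 i).
Proof. by rewrite /chi dot_delta. Qed.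

Definition subgroup G : Prop :=
  0 \in G /\ {in G &, forall x y, x + y \in G}.

Definition perp G : {set F2vec n} :=
  [set u | [forall x in G, dot u x == 0]].

Lemma perpP G u : reflect {in G, forall x, dot u x = 0} (u \in perp G).
Proof. by rewrite inE; apply: (iffP forall_inP) => P x /P /eqP. Qed.

Lemma subgroup_perp G : subgroup (perp G).
Proof.
split; first by apply/perpP => x _; rewrite dot0l.
move=> u v /perpP Gu /perpP Gv; apply/perpP => x Gx.
by rewrite dotDl Gu ?Gv ?addr0.
Qed.

Lemma subgroup_addl G x y : subgroup G -> x \in G -> (x + y \in G) = (y \in G).
Proof.
move=> [_ GD] Gx; apply/idP/idP => [Gxy|]; last exact: GD.
by rewrite -(addvK y x) [y + x]addrC GD.
Qed.

Lemma sum_subgroup_shift G x (F : F2vec n -> int) : subgroup G -> x \in G ->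
  \sum_(y in G) F (x + y) = \sum_(y in G) F y.
Proof.
move=> sG Gx; rewrite [RHS](reindex_inj (addrI x)) /=.
by apply: eq_bigl => y; rewrite subgroup_addl.
Qed.

(** If [chi u y = -1] for some [y] in [G], translating the summation by [y] negates the sum. *)
Lemma sum_chi G u : subgroup G ->
  \sum_(x in G) chi u x = if u \in perp G then #|G|%:Z else 0.
Proof.
move=> sG; case: perpP => [Gu | nGu].
  rewrite (eq_bigr (fun=> 1)) => [|x Gx]; last by rewrite /chi Gu.
  by rewrite sumr_const natz.
have /exists_inP[y Gy /negP uy] : [exists x in G, dot u x != 0].
  by apply/contra_notT: nGu; rewrite negb_exists_in => /forall_inP P x /P /negPn/eqP.
have chiN : chi u y = -1.
  by rewrite /chi; case: (F2_cases (dot u y)) uy => ->.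
have := sum_subgroup_shift (chi u) sG Gy.
under eq_bigr => x _ do rewrite chiDr chiN mulN1r.
rewrite sumrN; set s := bigop _ _ _; lia.
Qed.

Lemma sum_chi_all x : \sum_u chi u x = if x == 0 then (2 ^ n)%:Z else 0.
Proof.
have sT : subgroup [set: F2vec n] by split=> [|? ? ? ?]; rewrite inE.
have := sum_chi x sT; rewrite cardsT card_mx mul1n card_Fp //.
have -> : (x \in perp [set: F2vec n]) = (x == 0).
  apply/perpP/eqP => [Px | -> y _]; last exact: dot0l.
  by apply/rowP => i; rewrite mxE -dot_delta dotC Px ?inE.
by move <-; apply: eq_big => u; rewrite ?inE // => _; rewrite /chi dotC.
Qed.

(** Both sides evaluate the double sum of [chi u x] over all [u] and over [x] in [G], one for each
    order of summation. *)
Lemma card_perp G : subgroup G -> (#|perp G| * #|G| = 2 ^ n)%N.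
Proof.
move=> sG; apply/eqP; rewrite -eqz_nat; apply/eqP.
transitivity (\sum_u \sum_(x in G) chi u x).
  under eq_bigr => u _ do rewrite sum_chi //.
  by rewrite -big_mkcond sumr_const -mulr_natr natz mulrC -PoszM.
rewrite exchange_big /=; under eq_bigr => x _ do rewrite sum_chi_all.
by rewrite (bigD1 0) ?sG.1 //= eqxx big1 ?addr0 // => x /andP[_ /negbTE ->].
Qed.

(** Symmetry of [dot] gives one inclusion, and [card_perp] applied to [G] and to [perp G] gives
    equal sizes. *)
Lemma perpK G : subgroup G -> perp (perp G) = G.
Proof.
move=> sG; apply/esym/eqP; rewrite eqEcard; apply/andP; split.
  by apply/subsetP => x Gx; apply/perpP => u /perpP Gu; rewrite dotC Gu.
have := card_perp sG; have := card_perp (subgroup_perp G).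
have : (0 < 2 ^ n)%N by rewrite expn_gt0.
by nia.
Qed.

Definition supp x : {set 'I_n} := [set i | x 0 i != 0].
Definition wt x : nat := #|supp x|.

Lemma wt_eq0 x : (wt x == 0)%N = (x == 0).
Proof.
rewrite cards_eq0; apply/eqP/eqP => [s0 | ->].
  by apply/rowP => i; move/setP/(_ i): s0; rewrite !inE mxE => /negbFE/eqP.
by apply/setP => i; rewrite !inE mxE eqxx.
Qed.

Lemma wt_le x : (wt x <= n)%N.
Proof. by rewrite -[leqRHS]card_ord max_card. Qed.

Lemma hamming_distE x y : hamming_dist x y = wt (x + y).
Proof.
rewrite /hamming_dist /wt; congr #|pred_of_set _|; apply/setP => i.
by rewrite !inE mxE; case: (F2_cases (x 0 i)) => ->; case: (F2_cases (y 0 i)) => ->.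
Qed.

Lemma suppD x y : supp (x + y) = (supp x :\: supp y) :|: (supp y :\: supp x).
Proof.
apply/setP => i; rewrite !inE mxE.
by case: (F2_cases (x 0 i)) => ->; case: (F2_cases (y 0 i)) => ->.
Qed.

Lemma wtD x y : (wt (x + y) + (#|supp x :&: supp y|).*2 = wt x + wt y)%N.
Proof.
rewrite /wt suppD cardsU.
have -> : (supp x :\: supp y) :&: (supp y :\: supp x) = set0.
  by apply/setP => i; rewrite !inE; case: eqP; case: eqP.
rewrite cards0.
have := cardsID (supp y) (supp x); have := cardsID (supp x) (supp y).
rewrite [supp y :&: _]setIC; lia.
Qed.

Lemma dot_supp x y : (dot x y != 0) = odd #|supp x :&: supp y|.
Proof.
have -> : dot x y = #|supp x :&: supp y|%:R.
  rewrite -sumr_const /= [RHS]big_mkcond; apply: eq_bigr => i _; rewrite !inE.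
  by case: (F2_cases (x 0 i)) => ->; case: (F2_cases (y 0 i)) => ->; apply: val_inj.
by rewrite -(Fp_nat_mod (isT : prime 2)) modn2; case: odd.
Qed.

Lemma chi_supp u x : chi u x = \prod_(i in supp u) sgn (x 0 i).
Proof.
rewrite /chi sgn_sum [RHS]big_mkcond; apply: eq_bigr => i _; rewrite inE.
by case: (F2_cases (u 0 i)) => -> /=; rewrite ?mul0r ?mul1r.
Qed.

(** The quantity [n - 2 wt x], kept as a sum of signs so that its powers expand into characters of
    sums of unit vectors. *)
Definition bal x : int := \sum_i sgn (x 0 i).

Lemma balE x : bal x = n%:Z - (wt x)%:Z *+ 2.
Proof.
rewrite /bal (eq_bigr (fun i => 1 - (x 0 i != 0)%:Z *+ 2)) => [|i _].
  rewrite big_split /= sumrN sumr_const card_ord natz sumrMnl; congr (_ - _ *+ _).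
  rewrite /wt -sum1_card (big_morph Posz PoszD (erefl _)) [RHS]big_mkcond.
  by apply: eq_bigr => i _; rewrite inE; case: eqP.
by case: (F2_cases (x 0 i)) => ->.
Qed.

Lemma bal_shift (u k : F2vec n) :
  bal (u + k) = \sum_i chi (delta_mx 0 i) u * chi (delta_mx 0 i) k.
Proof. by apply: eq_bigr => i _; rewrite !chi_delta mxE sgnD. Qed.

Lemma balE_delta (k : F2vec n) : bal k = \sum_i chi (delta_mx 0 i) k.
Proof. by apply: eq_bigr => i _; rewrite chi_delta. Qed.

Lemma wt_delta i : wt (delta_mx 0 i : F2vec n) = 1%N.
Proof.
rewrite /wt (_ : supp _ = [set i]) ?cards1 //.
by apply/setP => j; rewrite !inE mxE eqxx /=; case: (j == i).
Qed.

Lemma wt_leD (x y : F2vec n) : (wt (x + y) <= wt x + wt y)%N.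
Proof. by rewrite -wtD leq_addr. Qed.

Lemma supp_ones : supp (const_mx 1 : F2vec n) = setT.
Proof. by apply/setP => i; rewrite !inE mxE. Qed.

Lemma wt_compl (x : F2vec n) : wt (x + const_mx 1) = (n - wt x)%N.
Proof.
have := wtD x (const_mx 1); rewrite /wt supp_ones setIT cardsT card_ord; lia.
Qed.

End Characters.

(** * Krawtchouk values and the linear programming bound *)

Fixpoint esym (l : seq int) (j : nat) : int :=
  match l, j with
  | [::], 0 => 1
  | [::], _.+1 => 0
  | _ :: _, 0 => 1
  | e :: l', j'.+1 => esym l' j'.+1 + e * esym l' j'
  end.

Lemma coef_prod_esym l j : (\prod_(e <- l) (1 + e *: 'X))`_j = esym l j.
Proof.
elim: l j => [|e l IHl] j; first by rewrite big_nil coef1; case: j.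
rewrite big_cons mulrDl mul1r -scalerAl coefD coefZ coefXM IHl.
by case: j => [|j] //=; rewrite ?mulr0 ?addr0 ?IHl //; case: (l).
Qed.

(** Both sides are the coefficient of ['X^j] in the product of the factors [1 + sgn (x 0 i) *: 'X].
    The right side is the Krawtchouk value of degree [j] at [wt x], in a form that computes. *)
Lemma sum_esym n (x : F2vec n) j :
  \sum_(A : {set 'I_n} | #|A| == j) \prod_(i in A) sgn (x 0 i) =
  esym (nseq (wt x) (-1) ++ nseq (n - wt x) 1) j.
Proof.
rewrite -coef_prod_esym big_cat /= !big_nseq !iter_mulr_1.
transitivity ((\prod_i (sgn (x 0 i) *: 'X + 1) : {poly int})`_j).
  rewrite bigA_distr coef_sum [LHS]big_mkcond; apply: eq_bigr => A _.
  rewrite -[\prod_(i : 'I_n) _]big_mkcond /= scaler_prod prodr_const coefZ coefXn eq_sym.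
  by case: eqP; rewrite ?mulr0 ?mulr1.
rewrite (bigID (mem (supp x))) /=; congr (polyseq (_ * _)%R)`_j.
  rewrite -[RHS]prodr_const; apply: eq_bigr => i; rewrite inE addrC.
  by case: (F2_cases (x 0 i)) => ->.
rewrite (_ : n - wt x = #|~: supp x|)%N; last first.
  by have := cardsC (supp x); rewrite card_ord /wt; lia.
rewrite -prodr_const; apply: eq_big => i; rewrite !inE // addrC.
by case: (F2_cases (x 0 i)) => ->.
Qed.

(* The coefficients of (s - 4) s (s + 4) (s + 16)^2 / 24, with s = 16 - 2 w, in
   the basis of Krawtchouk polynomials: the polynomial is nonpositive at the
   even weights w from 6 to 16, and 640 * 256 at w = 0. *)
Definition lp_coef : seq int := [:: 640; 430; 192; 95; 32; 5].

Definition lp_value (w : nat) : int :=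
  foldr +%R 0 [seq lp_coef`_j * esym (nseq w (-1) ++ nseq (16 - w) 1) j | j <- iota 0 6].

Lemma lp_value0 : lp_value 0 = 640 * 256.
Proof. by apply/eqP; vm_compute. Qed.

Lemma lp_value_le0 w : (6 <= w <= 16)%N -> ~~ odd w -> lp_value w <= 0.
Proof.
have /allP lp_le0 : all (fun w => ~~ odd w ==> (lp_value w <= 0)) (iota 6 11).
  by vm_compute.
by move=> w_bounds; apply/implyP/lp_le0; rewrite mem_iota.
Qed.

Lemma sum_lp (x : F2vec 16) :
  \sum_(A : {set 'I_16}) lp_coef`_#|A| * \prod_(i in A) sgn (x 0 i) = lp_value (wt x).
Proof.
rewrite /lp_value foldrE big_map -[iota 0 6]/(index_iota 0 6) big_mkord.
under [RHS]eq_bigr => j _ do rewrite -sum_esym mulr_sumr big_mkcond /=.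
rewrite exchange_big /=; apply: eq_bigr => A _.
have [ltA | geA] := ltnP #|A| 6.
  rewrite (bigD1 (Ordinal ltA)) //= eqxx [X in _ + X]big1 ?addr0 // => j.
  by rewrite -val_eqE /= eq_sym => /negbTE ->.
(* Sets of more than five elements read the default coefficient 0. *)
rewrite nth_default // mul0r [RHS]big1 // => j _.
by case: eqP => // Aj; move: geA (ltn_ord j); rewrite Aj; lia.
Qed.

(** Squared character sums weighted by [lp_coef] add up to the sum of [lp_value] over the distances
    of pairs in [C]. Only equal pairs contribute positively, so the total is at most
    [640 * 256 * #|C| = 640 * #|C| ^ 2]. The empty set alone already contributes this much, so every
    other term with a positive coefficient vanishes. *)
Lemma low_weight_character_sum (C : {set F2vec 16}) (u : F2vec 16) :
  #|C| = 256%N ->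
  {in C &, forall x y, ~~ odd (wt (x + y))} ->
  {in C &, forall x y, x != y -> (6 <= wt (x + y))%N} ->
  (1 <= wt u <= 5)%N -> \sum_(c in C) chi u c = 0.
Proof.
move=> cardC evenC dC wu.
pose f (A : {set 'I_16}) : int := \sum_(c in C) \prod_(i in A) sgn (c 0 i).
have fE : \sum_(A : {set 'I_16}) lp_coef`_#|A| * f A ^+ 2 =
    \sum_(c in C) \sum_(d in C) lp_value (wt (c + d)).
  transitivity (\sum_(c in C) \sum_(d in C) \sum_(A : {set 'I_16})
      lp_coef`_#|A| * \prod_(i in A) sgn ((c + d) 0 i)); last first.
    by do 2!(apply: eq_bigr => ? _); rewrite sum_lp.
  under [RHS]eq_bigr => c _ do rewrite exchange_big.
  rewrite exchange_big; apply: eq_bigr => A _ /=.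
  rewrite expr2 /f big_distrlr mulr_sumr; apply: eq_bigr => c _.
  rewrite mulr_sumr; apply: eq_bigr => d _; congr (_ * _).
  by under [RHS]eq_bigr => i _ do rewrite mxE sgnD; rewrite big_split.
have le_f : \sum_(A : {set 'I_16}) lp_coef`_#|A| * f A ^+ 2 <= 640 * #|C|%:Z ^+ 2.
  rewrite fE expr2 mulrA -[X in _ * X]natz mulr_natr -sumr_const.
  have wt0 : wt (0 : F2vec 16) = 0%N by apply/eqP; rewrite wt_eq0.
  apply: ler_sum => c Cc; rewrite (bigD1 c Cc) addvv wt0 lp_value0 cardC gerDl.
  apply: sumr_le0 => d /andP[Cd dc].
  by apply: lp_value_le0; rewrite ?evenC // dC 1?eq_sym // wt_le.
have coef_ge0 j : 0 <= lp_coef`_j by do 6?[case: j => [|j] //]; rewrite nth_default.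
move: le_f; rewrite (bigD1 set0) //= cards0 (bigD1 (supp u)) /=; last first.
  by rewrite -card_gt0; case/andP: wu.
have -> : f set0 = #|C|%:Z.
  by rewrite /f (eq_bigr (fun=> 1)) ?sumr_const ?natz // => c _; rewrite big_set0.
have : 0 <= \sum_(A | (A != set0) && (A != supp u)) lp_coef`_#|A| * f A ^+ 2.
  by apply: sumr_ge0 => A _; rewrite mulr_ge0 // sqr_ge0.
move: (bigop _ _ _) => S S_ge0.
rewrite gerDl => le_f; have le0 : lp_coef`_(wt u) * f (supp u) ^+ 2 <= 0.
  by apply: le_trans le_f; rewrite lerDl.
have coef_gt0 : 0 < lp_coef`_(wt u) by case: (wt u) wu => [|[|[|[|[|[|?]]]]]].
transitivity (f (supp u)); first by apply: eq_bigr => c _; rewrite chi_supp.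
move: le0; rewrite pmulr_rle0 // => le0; apply/eqP.
by rewrite -[_ == 0]sqrf_eq0 eq_le le0 sqr_ge0.
Qed.

(** * Incidence counting in Fano planes *)

Lemma sum_le1_eq_card (T : finType) (A : {pred T}) (f : T -> nat) :
  {in A, forall x, (f x <= 1)%N} -> (\sum_(x in A) f x)%N = #|A| ->
  {in A, forall x, f x = 1%N}.
Proof.
move=> f1 sumf x Ax.
have /eqP : (\sum_(y in A) (1 - f y) = 0)%N by rewrite sumnB // sumf sum1_card subnn.
rewrite sum_nat_eq0 => /forall_inP/(_ x Ax); have := f1 x Ax; lia.
Qed.

Section FanoPlanes.

Implicit Types (S : {set {set 'I_7}}) (L : {set 'I_7}).

Definition lines_through S (i j : 'I_7) := [set L in S | (i \in L) && (j \in L)].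

Lemma fano_lines_through S i j : fano_plane S -> i != j ->
  #|lines_through S i j| = 1%N.
Proof.
move=> [_ _ FS] /FS[L [[SL Li Lj] uniqL]].
suff -> : lines_through S i j = [set L] by rewrite cards1.
apply/setP => M; rewrite !inE; apply/and3P/eqP => [[SM Mi Mj] | -> //].
by rewrite (uniqL M).
Qed.

(** Incident pairs are counted by lines: each line through [i] has two further points. *)
Lemma sum_lines_through S i :
  (forall L, L \in S -> #|L| = 3%N) ->
  (\sum_(j | j != i) #|lines_through S i j| = 2 * #|[set L in S | i \in L]|)%N.
Proof.
move=> S3; transitivity (\sum_(j | j != i) \sum_(L in S | (i \in L) && (j \in L)) 1)%N.
  by apply: eq_bigr => j _; rewrite sum1dep_card.
rewrite (exchange_big_dep (fun L => (L \in S) && (i \in L))) /=; last first.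
  by move=> j L _ /and3P[-> ->].
rewrite mulnC -sum_nat_const; apply: eq_big => [L | L /andP[SL Li]].
  by rewrite inE.
transitivity #|L :\ i|; last by have := cardsD1 i L; rewrite Li (S3 L SL) add1n => -[<-].
by rewrite sum1dep_card; apply: eq_card => j; rewrite !inE SL Li.
Qed.

Lemma card_neq (i : 'I_7) : #|[pred j | j != i]| = 6%N.
Proof. by have := cardC1 i; rewrite card_ord. Qed.

(** Three lines pass through each point, so the three points of [L] lie on two other lines each. The
    six other lines thus share six incidences with [L], at most one per line. *)
Lemma fano_meet S L M : fano_plane S -> L \in S -> M \in S -> L != M ->
  #|L :&: M| = 1%N.
Proof.
move=> FS; have [S7 S3 _] := FS => SL SM LM.
have deg i : #|[set L' in S | i \in L']| = 3%N.
  have := sum_lines_through i S3.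
  rewrite (eq_bigr (fun=> 1%N)) => [|j ji]; last first.
    by rewrite fano_lines_through // eq_sym.
  by rewrite sum1_card card_neq => /eqP; rewrite -[6%N]/(2 * 3)%N eqn_pmul2l // => /eqP.
apply: (sum_le1_eq_card (A := S :\ L) (f := fun M => #|L :&: M|)); last first.
- by rewrite !inE eq_sym LM.
- transitivity (\sum_(L' in S :\ L) \sum_(i in L | i \in L') 1)%N.
    by apply: eq_bigr => L' _; rewrite sum1dep_card; congr #|pred_of_set _|;
      apply/setP => i; rewrite !inE.
  rewrite (exchange_big_dep (mem L)) /= => [|? ? _ /andP[] //].
  rewrite (eq_bigr (fun=> 2%N)) => [|i Li].
    rewrite sum_nat_const (S3 L SL); by have := cardsD1 L S; rewrite SL S7 add1n => -[<-].
  transitivity #|[set L' in S | i \in L'] :\ L|.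
    by rewrite sum1dep_card; apply: eq_card => L'; rewrite !inE Li -andbA.
  by have := cardsD1 L [set L' in S | i \in L']; rewrite deg inE SL Li add1n => -[<-].
move=> L' /setD1P[L'L SL']; rewrite leqNgt; apply/negP => /card_gt1P[i [j [iLL' jLL' ij]]].
have := fano_lines_through FS ij.
move/eqP/cards1P => [X XE]; move: L'L.
have : L \in lines_through S i j by move: iLL' jLL'; rewrite !inE SL => /andP[-> _] /andP[-> _].
have : L' \in lines_through S i j by move: iLL' jLL'; rewrite !inE SL' => /andP[_ ->] /andP[_ ->].
by rewrite XE !inE => /eqP -> /eqP ->; rewrite eqxx.
Qed.

(** Two points share at most one line. The seven lines have 7 * 6 ordered pairs of distinct points,
    and there are exactly 42 such pairs, so each pair is covered. *)
Lemma fano_of_meet S : #|S| = 7%N -> (forall L, L \in S -> #|L| = 3%N) ->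
  {in S &, forall L M, L != M -> #|L :&: M| = 1%N} -> fano_plane S.
Proof.
move=> S7 S3 meet; split=> // i j ij.
have le1 k l : k != l -> (#|lines_through S k l| <= 1)%N.
  move=> kl; rewrite leqNgt; apply/negP => /card_gt1P[L [M []]].
  rewrite !inE => /and3P[SL Lk Ll] /and3P[SM Mk Ml] /(meet _ _ SL SM) LM1.
  have : (1 < #|L :&: M|)%N.
    by apply/card_gt1P; exists k, l; rewrite !inE Lk Ll Mk Ml.
  by rewrite LM1.
pose A := [set kl : 'I_7 * 'I_7 | kl.2 != kl.1].
have sumA (F : 'I_7 -> 'I_7 -> nat) :
    (\sum_(kl in A) F kl.1 kl.2 = \sum_k \sum_(l | l != k) F k l)%N.
  by rewrite pair_big_dep; apply: eq_bigl => kl; rewrite inE.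
have cA : #|A| = 42%N.
  rewrite -sum1_card (sumA (fun _ _ => 1%N)) (eq_bigr (fun=> 6%N)) => [|k _].
    by rewrite sum_nat_const card_ord.
  by rewrite sum1_card card_neq.
have one : #|lines_through S i j| = 1%N.
  apply: (sum_le1_eq_card (A := A) (f := fun kl => #|lines_through S kl.1 kl.2|) _ _ (x := (i, j))).
  - by move=> kl; rewrite inE eq_sym => /le1.
  - rewrite cA (sumA (fun k l => #|lines_through S k l|)).
    under eq_bigr => k _ do rewrite sum_lines_through //.
    rewrite -big_distrr /= -[42%N]/(2 * 21)%N; congr (2 * _)%N.
    transitivity (\sum_k \sum_(L in S | k \in L) 1)%N.
      by apply: eq_bigr => k _; rewrite sum1dep_card.
    rewrite (exchange_big_dep (mem S)) /= => [|? ? _ /andP[] //].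
    rewrite (eq_bigr (fun=> 3%N)) ?sum_nat_const ?S7 // => L SL.
    by rewrite sum1dep_card -[RHS](S3 L SL); apply: eq_card => k; rewrite inE SL.
  - by rewrite inE /= eq_sym.
move/eqP/cards1P: one => [L LE]; exists L; split.
  by have : L \in lines_through S i j; [rewrite LE inE | rewrite inE => /and3P].
move=> M [SM Mi Mj]; have : M \in lines_through S i j by rewrite inE SM Mi.
by rewrite LE inE => /eqP ->.
Qed.

End FanoPlanes.

(** * Translates and kernels *)

Section Translates.

Variable n : nat.
Implicit Types (x y : F2vec n) (C : {set F2vec n}).

Lemma mem_translate x y C : (y \in translate x C) = (x + y \in C).
Proof.
apply/imsetP/idP => [[c Cc ->] | Cxy]; first by rewrite addrA addvv add0r.
by exists (x + y); rewrite // addrA addvv add0r.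
Qed.

Lemma card_translate x C : #|translate x C| = #|C|.
Proof. exact/card_imset/addrI. Qed.

Lemma translate0 C : translate 0 C = C.
Proof. by apply/setP => y; rewrite mem_translate add0r. Qed.

Lemma translateD x y C : translate (x + y) C = translate x (translate y C).
Proof. by apply/setP => z; rewrite !mem_translate addrA [y + x]addrC. Qed.

Lemma subgroup_Ker C : subgroup (Ker C).
Proof.
split=> [|x y]; rewrite !inE ?translate0 // => /eqP xC /eqP yC.
by rewrite translateD yC xC.
Qed.

Lemma eq_translate_Ker x y C :
  (translate x C == translate y C) = (x + y \in Ker C).
Proof.
rewrite inE; apply/eqP/eqP => [xy | Cxy].
  by rewrite translateD -xy -translateD addvv translate0.
by rewrite -[in RHS]Cxy -translateD addrC addvK.
Qed.

Lemma translate_subgroup x y C :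
  subgroup C -> x + y \in C -> translate x C = translate y C.
Proof.
move=> sC Cxy; apply/setP => z; rewrite !mem_translate.
by rewrite -(subgroup_addl (x + z) sC Cxy) addrACA addvv add0r.
Qed.

Lemma dot_suml (I : finType) (P : pred I) (F : I -> F2vec n) x :
  dot (\sum_(i | P i) F i) x = \sum_(i | P i) dot (F i) x.
Proof. by apply: (big_morph (fun u => dot u x)) => [? ?|]; rewrite ?dotDl ?dot0l. Qed.

End Translates.

Lemma translate_NR (x : F2vec 16) C :
  nordstrom_robinson C -> nordstrom_robinson (translate x C).
Proof.
move=> [cardC [dC [c [d [Cc Cd cd dcd]]]]]; split; first by rewrite card_translate.
have dist u v : hamming_dist (x + u) (x + v) = hamming_dist u v.
  by rewrite !hamming_distE addrACA addvv add0r.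
split=> [u v | ].
  rewrite !mem_translate -(dist u v) => Cu Cv uv; apply: dC => //.
  by rewrite (inj_eq (addrI x)).
exists (x + c), (x + d); rewrite !mem_translate !addrA !addvv !add0r dist.
by rewrite (inj_eq (addrI x)).
Qed.

(** * The extended Hamming code and the weights of its dual *)

Section ExtendedHamming.

Variable H : {set F2vec 16}.
Hypothesis sH : subgroup H.
Hypothesis cardH : #|H| = (2 ^ 11)%N.
Hypothesis dH : {in H, forall x, x != 0 -> (4 <= wt x)%N}.

Local Notation K := (perp H).
Let sK : subgroup K := subgroup_perp H.

Lemma card_dual : #|K| = 32%N.
Proof.
have := card_perp sH; rewrite cardH -[16%N]/(5 + 11)%N expnD.
by move/eqP; rewrite eqn_pmul2r ?expn_gt0 // => /eqP.
Qed.

Lemma sum_chi_dual u : \sum_(k in K) chi u k = if u \in H then 32 else 0.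
Proof. by rewrite sum_chi // perpK // card_dual. Qed.

Lemma dot_dual u x : u \in K -> x \in H -> dot u x = 0.
Proof. by move=> /perpP; apply. Qed.

Lemma delta2_in i j :
  (delta_mx 0 i + delta_mx 0 j \in H) = (i == j).
Proof.
case: eqP => [-> | /eqP ij]; first by rewrite addvv sH.1.
apply/negP => /dH; rewrite addv_eq0 => Hij.
suff /Hij : delta_mx 0 i != delta_mx 0 j :> F2vec 16.
  have := wt_leD (delta_mx 0 i) (delta_mx 0 j : F2vec 16); rewrite !wt_delta.
  by move=> le2 /leq_trans/(_ le2).
apply/eqP => /rowP/(_ i)/eqP; rewrite !mxE !eqxx (negbTE ij) /=.
by [].
Qed.

Lemma delta_notin i : delta_mx 0 i \notin H.
Proof.
apply/negP => /dH; rewrite wt_delta -wt_eq0 wt_delta => /(_ isT); lia.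
Qed.

Lemma delta3_notin i j l :
  delta_mx 0 i + delta_mx 0 j + delta_mx 0 l \notin H.
Proof.
have [<- | ij] := eqVneq i j; first by rewrite addvv add0r delta_notin.
have [-> | il] := eqVneq i l; first by rewrite addrAC addvv add0r delta_notin.
apply/negP => /dH.
have := wt_leD (delta_mx 0 i + delta_mx 0 j) (delta_mx 0 l : F2vec 16).
rewrite wt_delta => le2.
have := wt_leD (delta_mx 0 i) (delta_mx 0 j : F2vec 16); rewrite !wt_delta -(leq_add2r 1) => le1.
have {le1}le2 := leq_trans le2 le1.
suff nz : delta_mx 0 i + delta_mx 0 j + delta_mx 0 l != 0 :> F2vec 16.
  by move/(_ nz)/leq_trans/(_ le2); lia.
apply/eqP => /rowP/(_ i)/eqP; rewrite !mxE !eqxx (negbTE ij) (negbTE il) /=.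
by [].
Qed.

Lemma sum_bal : \sum_(k in K) bal k = 0.
Proof.
under eq_bigr => k _ do rewrite balE_delta.
rewrite exchange_big big1 //= => i _.
by rewrite sum_chi_dual (negbTE (delta_notin i)).
Qed.

(** The 16 diagonal terms give 32 each; the others vanish because a sum of two distinct unit vectors
    is not in [H]. The shift [u] makes the moment available on every coset of [K]. *)
Lemma sum_bal2 u : \sum_(k in K) bal (u + k) ^+ 2 = 512.
Proof.
under eq_bigr => k _ do rewrite expr2 !bal_shift big_distrlr.
rewrite exchange_big /=; under eq_bigr => i _ do rewrite exchange_big /=.
transitivity (\sum_(i : 'I_16) 32 : int); last by rewrite sumr_const card_ord.
apply: eq_bigr => i _; transitivity (\sum_(j : 'I_16)
    chi (delta_mx 0 i + delta_mx 0 j) u * (if i == j then 32 else 0)).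
  apply: eq_bigr => j _; rewrite -delta2_in -sum_chi_dual mulr_sumr.
  by apply: eq_bigr => k _; rewrite !chiDl mulrACA.
rewrite (bigD1 i) //= eqxx big1 ?addr0 ?addvv /chi ?dot0l // => j.
by rewrite eq_sym => /negbTE ->; rewrite mulr0.
Qed.

Lemma sum_bal3 : \sum_(k in K) bal k ^+ 3 = 0.
Proof.
transitivity (\sum_(k in K) \sum_i \sum_j \sum_l
    chi (delta_mx 0 i + delta_mx 0 j + delta_mx 0 l) k).
  apply: eq_bigr => k _; rewrite 2!exprS expr1 balE_delta mulr_suml.
  apply: eq_bigr => i _; rewrite big_distrlr mulr_sumr; apply: eq_bigr => j _.
  by rewrite mulr_sumr; apply: eq_bigr => l _; rewrite !chiDl mulrA.
rewrite exchange_big big1 //= => i _; rewrite exchange_big big1 //= => j _.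
rewrite exchange_big big1 //= => l _.
by rewrite sum_chi_dual (negbTE (delta3_notin i j l)).
Qed.

(* The sum of s^2 (s + 16) over K is attained by the zero word alone, and all
   terms are nonnegative. *)
Lemma dual_bal k : k \in K -> k != 0 -> bal k = 0 \/ bal k = -16.
Proof.
move=> Kk k0.
have bal0 : bal (0 : F2vec 16) = 16.
  by rewrite balE (eqP (_ : wt 0 == 0)%N) ?wt_eq0.
have sum0 : \sum_(x in K | x != 0) bal x ^+ 2 * (bal x + 16) = 0.
  have : \sum_(x in K) bal x ^+ 2 * (bal x + 16) = 512 * 16.
    under eq_bigr => x _ do rewrite mulrDr -exprSr.
    rewrite big_split /= sum_bal3 add0r -mulr_suml -(sum_bal2 0).
    by congr (_ * _); apply: eq_bigr => x _; rewrite add0r.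
  rewrite (bigD1 0) ?sK.1 //= bal0; set S := bigop _ _ _; lia.
have ge0 x : x \in K -> (x != 0) -> 0 <= bal x ^+ 2 * (bal x + 16).
  by move=> _ _; rewrite mulr_ge0 ?sqr_ge0 // balE; have := wt_le x; lia.
move: sum0 => /eqP; rewrite psumr_eq0 => [|x /andP[]]; last exact: ge0.
move=> /allP/(_ k); rewrite mem_index_enum Kk k0 /= => /(_ isT).
rewrite mulf_eq0 expf_eq0 /= => /orP[] /eqP; [by left | by right; lia].
Qed.

Lemma dual_wt k : k \in K -> exists2 i, (i <= 2)%N & wt k = (8 * i)%N.
Proof.
move=> Kk; have [->|k0] := eqVneq k 0.
  by exists 0%N => //; apply/eqP; rewrite wt_eq0.
have := wt_le k; case: (dual_bal Kk k0); rewrite balE => ? ?.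
  by exists 1%N => //; lia.
by exists 2 => //; lia.
Qed.

(** The zero word has balance 16 and all balances sum to 0, so some word has balance -16, that is,
    full support. *)
Lemma ones_dual : const_mx 1 \in K.
Proof.
have /exists_inP[k Kk /eqP balk] : [exists k in K, bal k == -16].
  apply/contraT; rewrite negb_exists_in => /forall_inP no.
  have := sum_bal; rewrite (bigD1 0) ?sK.1 //= big1 => [|k /andP[Kk k0]].
    by rewrite addr0 balE (eqP (_ : wt 0 == 0)%N) ?wt_eq0.
  by case: (dual_bal Kk k0) => // balk; have := no k Kk; rewrite balk eqxx.
suff <- : k = const_mx 1 by [].
have sk : supp k = setT.
  apply/eqP; rewrite eqEcard subsetT cardsT card_ord.
  by move: balk; rewrite balE /wt; lia.
apply/rowP => i; rewrite mxE; have : i \in supp k by rewrite sk inE.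
by rewrite inE; case: (F2_cases (k 0 i)) => ->.
Qed.

Lemma even_wt x : x \in H -> ~~ odd (wt x).
Proof.
move=> Hx; have := dot_dual ones_dual Hx.
by move/eqP/negPn; rewrite dot_supp supp_ones setTI.
Qed.

(** As [k], [l] and [k + l] have weights divisible by 8, their supports meet in a multiple of 4
    positions, so [K] is self-orthogonal. *)
Lemma dual_sub : {subset K <= H}.
Proof.
move=> k Kk; rewrite -(perpK sH); apply/perpP => l Kl.
apply/eqP/negPn; rewrite dot_supp; have := wtD k l.
have [i _ ->] := dual_wt Kk; have [j _ ->] := dual_wt Kl.
have [m _ ->] := dual_wt (sK.2 _ _ Kk Kl); lia.
Qed.

(* If all weights in the coset of [u] lie in 6..10, the second moment of the
   balances forces them to be 6 or 10, hence congruent mod 4, so [u] is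
   orthogonal to the dual. *)
Lemma low_weight_coset u : u \notin H ->
  exists2 k, k \in K & (1 <= wt (u + k) <= 5)%N.
Proof.
move=> uH; apply/exists_inP; apply/contraNT: uH.
rewrite negb_exists_in => /forall_inP nolow.
have [Ku|nKu] := boolP (u \in K); first exact: dual_sub.
(* Weight 0 is excluded by [u \notin K]; adding the all-one word turns a weight [w] into [16 - w],
   which excludes the weights above 10. *)
have wt_bounds k : k \in K -> (6 <= wt (u + k) <= 10)%N.
  move=> Kk; have := nolow _ Kk; have := nolow _ (sK.2 _ _ Kk ones_dual).
  rewrite addrA wt_compl.
  have nz l : l \in K -> (0 < wt (u + l))%N.
    by rewrite lt0n wt_eq0 addv_eq0 => Kl; apply: contraNneq nKu => ->.
  have := nz _ Kk; have := nz _ (sK.2 _ _ Kk ones_dual).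
  by rewrite addrA wt_compl; have := wt_le (u + k); move: (wt _) => w; lia.
have sum0 : \sum_(k in K) (16 - bal (u + k) ^+ 2) = 0.
  by rewrite big_split /= sumrN sum_bal2 sumr_const card_dual.
have wt610 k : k \in K -> (wt (u + k) == 6%N) || (wt (u + k) == 10%N).
  move=> Kk; move/eqP: sum0; rewrite psumr_eq0 => [|l /wt_bounds]; last first.
    by rewrite balE => ?; nia.
  move=> /allP/(_ k); rewrite mem_index_enum Kk /= => /(_ isT).
  by have := wt_bounds _ Kk; rewrite balE; nia.
rewrite -(perpK sH); apply/perpP => k Kk; apply/eqP/negPn; rewrite dot_supp.
have [i _ wtk] := dual_wt Kk; have := wtD u k; rewrite wtk.
move: (wt610 _ Kk) (wt610 _ sK.1); rewrite addr0.
move: (wt (u + k)) (wt u) #|_| => w1 w2 m; lia.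
Qed.

(** * The quadratic form on [H] modulo its dual *)

Definition half_wt_parity (x : F2vec 16) : bool := odd (wt x)./2.
Local Notation q := half_wt_parity.

Lemma parityD x y : x \in H -> y \in H ->
  q (x + y) = q x (+) q y (+) (dot x y != 0).
Proof.
move=> Hx Hy; rewrite dot_supp /q.
move: (even_wt Hx) (even_wt Hy) (wtD x y).
move: (wt (x + y)) (wt x) (wt y) #|_| => w w1 w2 m; lia.
Qed.

Lemma parity_dual k : k \in K -> q k = false.
Proof. by move=> /dual_wt[i _ wtk]; rewrite /q wtk; lia. Qed.

Lemma parity_addK x k : x \in H -> k \in K -> q (x + k) = q x.
Proof.
move=> Hx Kk; rewrite parityD ?(dual_sub Kk) // (parity_dual Kk) addbF.
by rewrite dotC (dot_dual Kk Hx) addbF.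
Qed.

(** All weights in the coset are multiples of 4, and 0 and 16 do not occur. Without 4, hence without
    12, all of them are 8 and all balances vanish, against the second moment 512. *)
Lemma parity_even_coset x : x \in H -> x \notin K -> ~~ q x ->
  exists2 k, k \in K & wt (x + k) = 4%N.
Proof.
move=> Hx nKx qx.
suff /exists_inP[k Kk /eqP wtk] : [exists k in K, wt (x + k) == 4%N] by exists k.
apply/contraT; rewrite negb_exists_in => /forall_inP no4.
have wt8 k : k \in K -> wt (x + k) = 8%N.
  move=> Kk; have K1k := sK.2 _ _ Kk ones_dual.
  have nz l : l \in K -> (0 < wt (x + l))%N.
    by rewrite lt0n wt_eq0 addv_eq0 => Kl; apply: contraNneq nKx => ->.
  move: (no4 _ Kk) (no4 _ K1k) (nz _ Kk) (nz _ K1k) (wt_le (x + k)).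
  rewrite addrA wt_compl; move: qx; rewrite -(parity_addK Hx Kk) /q.
  have Hxk : x + k \in H by rewrite sH.2 ?(dual_sub Kk).
  by move: (even_wt Hxk); move: (wt (x + k)) => w; lia.
have := sum_bal2 x; rewrite big1 // => k Kk.
by rewrite balE wt8.
Qed.

(** * Nordstrom-Robinson codes inside the Hamming code *)

Lemma NR_min_wt C : nordstrom_robinson C ->
  {in C &, forall x y, x != y -> (6 <= wt (x + y))%N}.
Proof. by move=> [_ [dC _]] x y Cx Cy xy; rewrite -hamming_distE dC. Qed.

(** Fourier inversion: the character sums of [C] live on [H], whose characters do not distinguish
    [c] from [c + k]. *)
Lemma NR_dual_invariant C : nordstrom_robinson C -> C \subset H ->
  {in C & K, forall c k, c + k \in C}.
Proof.
move=> NRC /subsetP CH.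
have hat0 u : u \notin H -> \sum_(c in C) chi u c = 0.
  move=> /low_weight_coset[k Kk wtuk].
  (* Characters from [K] are trivial on [C], so [u] may be replaced by a word of weight 1 to 5 in
     its coset. *)
  transitivity (\sum_(c in C) chi (u + k) c).
    apply: eq_bigr => c Cc.
    by rewrite chiDl [X in _ * X]/chi (dot_dual Kk) ?mulr1 ?CH.
  apply: low_weight_character_sum NRC.1 _ (NR_min_wt NRC) wtuk.
  by move=> x y Cx Cy; rewrite even_wt ?sH.2 ?CH.
have inversion x :
    \sum_u (\sum_(c in C) chi u c) * chi u x = (x \in C)%:Z * (2 ^ 16)%:Z.
  under eq_bigr => u _ do rewrite mulr_suml.
  rewrite exchange_big /=.
  under eq_bigr => c _ do under eq_bigr => u _ do rewrite -chiDr.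
  under eq_bigr => c _ do rewrite sum_chi_all addv_eq0.
  have [Cx | nCx] := boolP (x \in C); last first.
    by rewrite mul0r big1 // => c Cc; case: eqP Cc nCx => // -> ->.
  rewrite (bigD1 x Cx) /= eqxx mul1r big1 ?addr0 //.
  by move=> c /andP[_ /negbTE ->].
move=> c k Cc Kk; have := inversion c; have := inversion (c + k).
rewrite (eq_bigr (fun u => (\sum_(d in C) chi u d) * chi u c)) => [|u _]; last first.
  have [Hu | nHu] := boolP (u \in H); last by rewrite hat0 ?mul0r.
  by rewrite chiDr [X in _ * (_ * X)]/chi dotC (dot_dual Kk Hu) mulr1.
rewrite Cc => -> /eqP; by case: (c + k \in C).
Qed.

(** Otherwise some [k] in [K] gives [c + k + d] weight 4, although [c + k] is again a codeword. *)
Lemma NR_parity C : nordstrom_robinson C -> C \subset H ->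
  {in C &, forall c d, c + d \notin K -> q (c + d)}.
Proof.
move=> NRC CH c d Cc Cd nK; have Hcd : c + d \in H by rewrite sH.2 ?(subsetP CH).
apply/contraT => /(parity_even_coset Hcd nK)[k Kk].
rewrite addrAC => wt4; have := NR_min_wt NRC (NR_dual_invariant NRC CH Cc Kk) Cd.
rewrite wt4; have [ckd _ | _ /(_ isT) //] := eqVneq (c + k) d.
by move: nK; rewrite -ckd addrA addvv add0r Kk.
Qed.

(** * The coset representatives of [N] and the 64 cosets of [K] in [H] *)

Section Frame.

Variables (N : {set F2vec 16}) (a : 'I_7 -> F2vec 16).
Hypothesis NRN : nordstrom_robinson N.
Hypothesis N0 : 0 \in N.
Hypothesis N_cosets : coset_decomposition N a.
Hypothesis NH : N \subset H.

Lemma dual_sub_Ker C : nordstrom_robinson C -> C \subset H -> K \subset Ker C.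
Proof.
move=> NRC CH; apply/subsetP => k Kk; rewrite inE; apply/eqP/setP => y.
rewrite mem_translate; apply/idP/idP => [Cky | Cy].
  by rewrite -(addvK y k) [y + k]addrC NR_dual_invariant.
by rewrite addrC NR_dual_invariant.
Qed.

(** [None] is the eighth point, standing for the coset [Ker N] itself; the eight cosets are then
    treated uniformly. *)
Definition coset_rep (o : option 'I_7) : F2vec 16 := oapp a 0 o.
Local Notation b := coset_rep.

Lemma coset_rep_inj_Ker o p : o != p -> b o + b p \notin Ker N.
Proof.
have [_ nK inj] := N_cosets; have sKer := subgroup_Ker N.
have nKi i : a i \notin Ker N.
  apply/negP => Ki; apply: (nK i).
  by rewrite (translate_subgroup (y := 0) sKer) ?addr0 // translate0.
case: o p => [i|] [j|] //= ij; rewrite ?addr0 ?add0r //.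
apply/negP => Kij; move/eqP: ij; apply; congr Some; apply: inj.
exact: translate_subgroup.
Qed.

Lemma coset_rep_in o : b o \in N.
Proof.
case: o => [i|] //=; have [-> _ _] := N_cosets; apply/setUP; right.
by apply/bigcupP; exists i => //; rewrite mem_translate addvv (subgroup_Ker N).1.
Qed.

(** Eight disjoint cosets of [Ker N] fit into 256 words, so [Ker N] has at most 32 elements, the
    size of its subset [K]. *)
Lemma Ker_eq_dual : Ker N = K.
Proof.
symmetry; apply/eqP; rewrite eqEcard dual_sub_Ker // card_dual.
have sKer := subgroup_Ker N.
pose f (z : option 'I_7 * F2vec 16) := b z.1 + z.2.
have injf : {in setX setT (Ker N) &, injective f}.
  move=> [o x] [p y] /setXP[/= _ Kx] /setXP[/= _ Ky]; rewrite /f /= => bxy.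
  suff op : o = p by move: bxy; rewrite op => /addrI ->.
  apply/eqP/contraT => /coset_rep_inj_Ker; rewrite -(subgroup_addl (b o + b p) sKer Kx).
  by rewrite addrA [x + b o]addrC bxy addrAC addvv add0r Ky.
have : (#|f @: setX setT (Ker N)| <= #|N|)%N.
  apply/subset_leq_card/subsetP => _ /imsetP[[o x] /setXP[_ /= Kx] ->].
  move: Kx; rewrite inE => /eqP Kx.
  by rewrite /f /= -Kx mem_translate [x + _]addrC addvK coset_rep_in.
rewrite card_in_imset // cardsX cardsT card_option card_ord NRN.1.
by rewrite -[256%N]/(8 * 32)%N leq_pmul2l.
Qed.

Lemma rep_in o : b o \in H.
Proof. exact/(subsetP NH)/coset_rep_in. Qed.

Lemma a_in i : a i \in H.
Proof. exact: (rep_in (Some i)). Qed.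

Lemma mem_NP y : reflect (exists o, b o + y \in K) (y \in N).
Proof.
apply: (iffP idP) => [|[o Kby]]; last first.
  by have := NR_dual_invariant NRN NH (coset_rep_in o) Kby; rewrite addrA addvv add0r.
have [-> _ _] := N_cosets; rewrite Ker_eq_dual => /setUP[Ky | /bigcupP[i _]].
  by exists None; rewrite add0r.
by rewrite mem_translate => Kay; exists (Some i).
Qed.

Lemma parity_rep o p : o != p -> q (b o + b p).
Proof.
move=> /coset_rep_inj_Ker; rewrite Ker_eq_dual.
by apply: (NR_parity NRN NH); apply: coset_rep_in.
Qed.

Lemma parity_a i : q (a i).
Proof. by have := @parity_rep (Some i) None isT; rewrite addr0. Qed.

Lemma dot_a i j : dot (a i) (a j) = (i != j)%:R.
Proof.
have [<- | ij] := eqVneq i j.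
  by apply/eqP/negPn; rewrite dot_supp setIid; apply: even_wt (a_in i).
have := @parity_rep (Some i) (Some j) ij; rewrite parityD ?a_in // !parity_a /=.
by case: (F2_cases (dot (a i) (a j))) => ->.
Qed.

Definition asum (T : {set 'I_7}) : F2vec 16 := \sum_(i in T) a i.

Lemma subgroup_sum (G : {set F2vec 16}) (I : finType) (P : pred I) (F : I -> F2vec 16) :
  subgroup G -> (forall i, P i -> F i \in G) -> \sum_(i | P i) F i \in G.
Proof. by move=> [G0 GD] GF; apply: (big_ind (fun x => x \in G)) => // x y; apply: GD. Qed.

Lemma asum_in T : asum T \in H.
Proof. by apply: subgroup_sum => // i _; apply: a_in. Qed.

Lemma asumD A B : asum A + asum B = asum ((A :\: B) :|: (B :\: A)).
Proof.
rewrite /asum !(big_mkcond (fun i => i \in _)) -big_split; apply: eq_bigr => i _.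
by rewrite !inE /=; case: (i \in A); case: (i \in B); rewrite /= ?addvv ?addr0 ?add0r.
Qed.

Lemma asumC T : asum (~: T) = asum T + asum setT.
Proof. by rewrite asumD setDT set0U setTD. Qed.

Lemma dot_asum T j : (dot (asum T) (a j) != 0) = odd #|T :\ j|.
Proof.
have -> : dot (asum T) (a j) = #|T :\ j|%:R.
  rewrite /asum dot_suml -sumr_const [RHS]big_mkcond [LHS]big_mkcond /=.
  apply: eq_bigr => i _; rewrite !inE dot_a.
  by case: (i == j); case: (i \in T).
by rewrite -(Fp_nat_mod (isT : prime 2)) modn2; case: odd.
Qed.

(** Orthogonality to every [a j] makes each [#|T :\ j|] even. A point inside [T] and one outside
    would make both [#|T| - 1] and [#|T|] even. *)
Lemma asum_dual T : asum T \in K -> T = set0 \/ T = setT.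
Proof.
move=> KT; have evenT j : ~~ odd #|T :\ j|.
  by rewrite -dot_asum (dot_dual KT (a_in j)) eqxx.
have [-> | [i Ti]] := set_0Vmem T; [by left | right].
apply/setP => j; rewrite inE; apply/contraT => nTj.
have TDj : T :\ j = T by apply/setDidPl; rewrite disjoint_sym disjoints1.
by have := evenT i; have := evenT j; rewrite TDj (cardsD1 i T) Ti /= => /negPn ->.
Qed.

Lemma card_le7 (T : {set 'I_7}) : (#|T| <= 7)%N.
Proof. by rewrite -[leqRHS]card_ord max_card. Qed.

(** Adding a point to [m] points changes the form by 1 plus the polar term [m], which is the
    recursion of the triangular numbers. *)
Lemma parity_asum_bin T : q (asum T) = odd 'C(#|T|.+1, 2).
Proof.
move: {2}#|T| (erefl #|T|) => m; elim: m T => [|m IHm] T cT.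
  by rewrite cT (cards0_eq cT) /asum big_set0 parity_dual ?sK.1.
have [i Ti] : exists i, i \in T by apply/card_gt0P; rewrite cT.
have cT' : #|T :\ i| = m by have := cardsD1 i T; rewrite cT Ti => -[].
have -> : asum T = asum (T :\ i) + a i by rewrite addrC /asum (big_setD1 i).
rewrite parityD ?asum_in ?a_in // parity_a IHm // cT' cT dot_asum setDDl setUid cT'.
by rewrite [in RHS]binS bin1 oddD /=; case: odd; case: odd.
Qed.

Lemma parity_asum T : q (asum T) = (#|T| \in [:: 1; 2; 5; 6]%N).
Proof.
by rewrite parity_asum_bin; move: #|T| (card_le7 T); do 8?[case=> //].
Qed.

Lemma card_symdiff (T : finType) (A B : {set T}) :
  (#|(A :\: B) :|: (B :\: A)| + (#|A :&: B|).*2 = #|A| + #|B|)%N.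
Proof.
have disj : [disjoint A :\: B & B :\: A].
  by rewrite -setI_eq0; apply/eqP/setP => i; rewrite !inE; case: (i \in A); case: (i \in B).
have := leq_card_setU (A :\: B) (B :\: A) => /leqifP; rewrite disj => /eqP ->.
have := cardsID B A; have := cardsID A B; rewrite [B :&: A]setIC => <- <-.
by move: #|A :\: B| #|B :\: A| #|A :&: B| => m1 m2 m3; lia.
Qed.

(* Distinct subsets avoiding the point 0 have symmetric difference neither
   empty nor full, so their sums represent all 64 cosets of K in H. *)
Lemma asum_span x : x \in H -> exists2 T : {set 'I_7}, ord0 \notin T & asum T + x \in K.
Proof.
pose D := powerset [set~ ord0 : 'I_7].
pose f (z : {set 'I_7} * F2vec 16) := asum z.1 + z.2.
have D0 A : A \in D -> ord0 \notin A by rewrite powersetE subsetC sub1set inE.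
have injf : {in setX D K &, injective f}.
  move=> [A x'] [B y'] /setXP[/= DA Kx'] /setXP[/= DB Ky']; rewrite /f /= => fxy.
  have sK' : asum A + asum B \in K.
    rewrite -(subgroup_addl _ sK Kx') addrA [x' + _]addrC fxy.
    by rewrite addrAC addvv add0r.
  suff AB : A = B by move: fxy; rewrite AB => /addrI ->.
  move: sK'; rewrite asumD => /asum_dual[/eqP | /setP/(_ ord0)].
    by rewrite setU_eq0 !setD_eq0 -eqEsubset => /eqP.
  by rewrite !inE (negbTE (D0 _ DA)) (negbTE (D0 _ DB)).
have fH : f @: setX D K = H.
  apply/eqP; rewrite eqEcard; apply/andP; split.
    apply/subsetP => _ /imsetP[[A k] /setXP[/= _ Kk] ->].
    by rewrite sH.2 ?asum_in ?(dual_sub Kk).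
  rewrite card_in_imset // cardsX card_powerset cardsC1 card_ord card_dual cardH.
  by rewrite -[11%N]/(6 + 5)%N expnD leq_mul.
move=> Hx; have : x \in f @: setX D K by rewrite fH.
move=> /imsetP[[A k] /setXP[/= DA Kk] ->]; exists A.
  exact: D0.
by rewrite /f /= addrA addvv add0r.
Qed.

(** Representing [a ord0] by a set avoiding [ord0] gives a relation modulo [K] on a nonempty set,
    which must be everything. *)
Lemma asum_setT : asum setT \in K.
Proof.
have [T nT] := asum_span (a_in ord0).
rewrite addrC /asum -big_setU1 // => /asum_dual[/setP/(_ ord0) | <- //].
by rewrite !inE eqxx.
Qed.

(** A set and its complement represent the same coset, and their sizes have opposite parities since
    7 is odd. *)
Lemma asum_span_parity x e : x \in H ->
  exists T : {set 'I_7}, odd #|T| = e /\ asum T + x \in K.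
Proof.
move=> /asum_span[T _ KT]; have [Te | Te] := eqVneq (odd #|T|) e; first by exists T.
exists (~: T); rewrite cardsCs setCK card_ord; split.
  by rewrite oddB ?card_le7 //; move: Te; case: odd; case: (e).
by rewrite asumC addrAC sK.2 ?asum_setT.
Qed.

Lemma parity_coset x y : x \in H -> y \in H -> x + y \in K -> q x = q y.
Proof. by move=> Hx Hy Kxy; rewrite -(parity_addK Hx Kxy) addrA addvv add0r. Qed.

(** An even set with [q = 1] has size 2 or 6; in the second case the complement is one point, which
    is paired with [None]. *)
Lemma parity1_edge x : x \in H -> q x ->
  exists o p : option 'I_7, o != p /\ b o + b p + x \in K.
Proof.
move=> Hx qx; have [T [Te KT]] := asum_span_parity false Hx.
have := parity_coset (asum_in T) Hx KT; rewrite qx parity_asum !inE.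
have le7 := card_le7 T.
have [cT _ | cT6] := eqVneq #|T| 2%N.
  have /cards2P[i [j [ij TE]]] : #|T| == 2%N by rewrite cT.
  exists (Some i), (Some j); split=> //.
  by move: KT; rewrite TE /asum big_setU1 ?inE // big_set1.
have [cT _ | cT2] := eqVneq #|T| 6%N; last first.
  by move: Te cT6 cT2 le7; move: #|T|; do 8?[case=> //].
have /cards1P[i TE] : #|~: T| == 1%N by rewrite cardsCs setCK card_ord cT.
exists (Some i), None; split=> //; rewrite /= addr0.
have -> : a i = asum [set i] by rewrite /asum big_set1.
by rewrite -TE asumC addrAC sK.2 ?asum_setT.
Qed.

(** An odd set with [q = 0] has size 3 or 7, and size 7 would put [x] in [K]. *)
Lemma parity0_triple x : x \in H -> x \notin K -> ~~ q x ->
  exists T : {set 'I_7}, #|T| = 3%N /\ asum T + x \in K.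
Proof.
move=> Hx nKx qx; have [T [Te KT]] := asum_span_parity true Hx.
have := parity_coset (asum_in T) Hx KT; rewrite (negbTE qx) parity_asum !inE => qT.
have le7 := card_le7 T.
exists T; split=> //; have [cT | cT7] := eqVneq #|T| 7%N; last first.
  by move: Te qT cT7 le7; move: #|T|; do 8?[case=> //].
have TT : T = setT by apply/eqP; rewrite eqEcard subsetT cardsT card_ord cT.
by move: nKx; rewrite -(subgroup_addl x sK asum_setT) -TT KT.
Qed.

(** * Sums of representatives and intersections of translates of [N] *)

Lemma uniq_pmap_id (T : eqType) (s : seq (option T)) : uniq s -> uniq (pmap id s).
Proof. by apply: (pmap_uniq (g := Some)); case. Qed.

Lemma rep_sum_uniq (s : seq (option 'I_7)) : uniq s ->
  \sum_(o <- s) b o = asum [set i in pmap id s].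
Proof.
move=> us; transitivity (\sum_(i <- pmap id s) a i); first by rewrite big_pmap.
rewrite big_uniq ?uniq_pmap_id //.
by apply: eq_bigl => i; rewrite inE.
Qed.

(** Dropping a possible [None] leaves three or four of the [a i], sizes at which [q] vanishes. *)
Lemma rep4_parity o p r s : uniq [:: o; p; r; s] ->
  ~~ q (b o + b p + (b r + b s)) /\ b o + b p + (b r + b s) \notin K.
Proof.
move=> us; have := rep_sum_uniq us; rewrite !big_cons big_nil addr0 -addrA addrA => ->.
have : #|[set i in pmap id [:: o; p; r; s]]| \in [:: 3; 4]%N.
  rewrite cardsE (card_uniqP _) ?uniq_pmap_id // size_pmap.
  move: us; rewrite /= !inE.
  by case: o => [o|]; case: p => [p|]; case: r => [r|]; case: s => [s|]; rewrite /= ?orbT ?andbF.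
move: [set i in _] => T cT; split; first by rewrite parity_asum; move: cT; rewrite !inE => /orP[] /eqP ->.
by apply: contraTN cT => /asum_dual[] ->; rewrite ?cards0 ?cardsT ?card_ord.
Qed.

(** A common word would put [x + y] in the coset of some [b o + b p], which is [K] when [o = p] and
    has [q = 1] otherwise. *)
Lemma translate_disjoint x y : x \in H -> y \in H ->
  x + y \notin K -> ~~ q (x + y) -> [disjoint translate x N & translate y N].
Proof.
move=> Hx Hy nK qxy; rewrite -setI_eq0; apply/eqP/setP => z.
rewrite !inE !mem_translate; apply/negP => /andP[/mem_NP[o Ko] /mem_NP[p Kp]].
have := sK.2 _ _ Ko Kp; rewrite addrACA [x + z + _]addrACA addvv addr0.
have [-> | op] := eqVneq o p; first by rewrite addvv add0r; apply/negP.
move/(parity_coset (sH.2 _ _ (rep_in o) (rep_in p)) (sH.2 _ _ Hx Hy)).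
by rewrite parity_rep // (negbTE qxy).
Qed.

Lemma translate_meet x y : x \in H -> y \in H -> q (x + y) ->
  ~~ [disjoint translate x N & translate y N].
Proof.
move=> Hx Hy /(parity1_edge (sH.2 _ _ Hx Hy))[o [p [_ Kop]]].
rewrite -setI_eq0; apply/set0Pn; exists (x + b o).
rewrite inE !mem_translate addrA addvv add0r coset_rep_in; apply/mem_NP; exists p.
suff -> : b p + (y + (x + b o)) = b o + b p + (x + y) by [].
by apply/rowP => i; rewrite !mxE; ring.
Qed.

(** * Nordstrom-Robinson codes in [H] as stars *)

Lemma dual_escape (C : {set F2vec 16}) (s : seq (F2vec 16)) :
  (32 * size s < #|C|)%N -> exists2 c, c \in C & all (fun e => e + c \notin K) s.
Proof.
move=> cardC; pose D := [set c in C | all (fun e => e + c \notin K) s].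
have : (#|C| <= #|D| + 32 * size s)%N.
  rewrite /D => {cardC D}; elim: s => [|e s IHs].
    by rewrite muln0 addn0 subset_leq_card //; apply/subsetP => c; rewrite inE andbT.
  apply: (leq_trans IHs); set D := [set c in C | _].
  rewrite mulnS addnA leq_add2r -(cardsID (translate e K) D) addnC leq_add //.
    apply/subset_leq_card/subsetP => c /setDP[]; rewrite mem_translate inE.
    by move=> /andP[Cc all_c] nK; rewrite inE Cc /= nK.
  by rewrite -card_dual -[leqRHS](card_translate e) subset_leq_card // subsetIr.
move=> leC; have /card_gt0P[c] : (0 < #|D|)%N by lia.
by rewrite inE => /andP[Cc all_c]; exists c.
Qed.

Section CliqueIsStar.

Variables (C : {set F2vec 16}) (c0 : F2vec 16).
Hypotheses (NRC : nordstrom_robinson C) (CH : C \subset H) (Cc0 : c0 \in C).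

Let edge o p c := b o + b p + (c0 + c) \in K.

Lemma edgeC o p c : edge o p c = edge p o c.
Proof. by rewrite /edge [b o + _]addrC. Qed.

Lemma edge_exists c : c \in C -> c0 + c \notin K ->
  exists o p, o != p /\ edge o p c.
Proof.
move=> Cc nK; apply: parity1_edge; first by rewrite sH.2 ?(subsetP CH).
exact: (NR_parity NRC CH).
Qed.

(** Disjoint edges would put [c + d] in the coset of a sum of four distinct representatives, outside
    [K] and with [q = 0], against [NR_parity]. *)
Lemma edges_meet c d o p r s : c \in C -> d \in C -> o != p -> r != s ->
  edge o p c -> edge r s d -> [|| o == r, o == s, p == r | p == s].
Proof.
move=> Cc Cd op rs Ec Ed; apply/contraT; rewrite !negb_or => /and4P[or os pr ps].
have [] := @rep4_parity o p r s; first by rewrite /= !inE !negb_or op or os pr ps rs.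
set y := b o + b p + (b r + b s) => qy nKy.
have Hcd : c + d \in H by rewrite sH.2 ?(subsetP CH).
have Hy : y \in H by do 3?apply: sH.2; apply: rep_in.
have Kycd : y + (c + d) \in K.
  have := sK.2 _ _ Ec Ed.
  by rewrite addrACA [c0 + c + _]addrACA addvv add0r.
have [Kcd | nKcd] := boolP (c + d \in K).
  by rewrite addrC subgroup_addl // (negbTE nKy) in Kycd.
by move: qy; rewrite (parity_coset Hy Hcd Kycd) (NR_parity NRC CH).
Qed.

(* Pairwise meeting edges form a star or a triangle, and a triangle accounts
   for four cosets of K only. *)
Lemma star_center : exists o, {in C, forall c, exists p, edge o p c}.
Proof.
have [c1 Cc1] := @dual_escape C [:: c0] (etrans (congr1 _ NRC.1) (erefl _)).
rewrite /= andbT => /(edge_exists Cc1)[o [p [op E1]]].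
have off_center o' : [forall c in C, [exists p, edge o' p c]] \/
    exists c (r s : option 'I_7), [/\ c \in C, r != s, edge r s c & (r != o') && (s != o')].
  have [|nst] := boolP [forall c in C, [exists p, edge o' p c]]; [by left | right].
  move: nst => /forall_inPn[c Cc /existsPn noE].
  have nK : c0 + c \notin K by have := noE o'; rewrite /edge addvv add0r.
  have [r [s [rs E]]] := edge_exists Cc nK; exists c, r, s; split=> //.
  by apply/andP; split; apply: contraTneq E => ->; rewrite ?noE // edgeC noE.
have star o' : [forall c in C, [exists p, edge o' p c]] ->
    exists o, {in C, forall c, exists p, edge o p c}.
  by move=> /forall_inP st; exists o' => c /st /existsP.
have [/star // | [c2 [r2 [s2 [C2 rs2 E2 /andP[ro2 so2]]]]]] := off_center o.
have [/star // | [c3 [r3 [s3 [C3 rs3 E3 /andP[rp3 sp3]]]]]] := off_center p.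
(* The second edge avoids [o] but meets the edge [o p], so it passes through [p]. *)
have [r [ro rp E2']] : exists r, [/\ r != o, r != p & edge p r c2].
  have := edges_meet Cc1 C2 op rs2 E1 E2.
  rewrite ![o == _]eq_sym (negbTE ro2) (negbTE so2) /= => /orP[] /eqP pE.
    by exists s2; rewrite pE E2 so2 eq_sym rs2.
  by exists r2; rewrite pE edgeC E2 ro2 rs2.
(* The third edge avoids [p] and meets both [o p] and [p r], so it closes the triangle. *)
have E3' : edge o r c3.
  have pr : p != r by rewrite eq_sym.
  have := edges_meet Cc1 C3 op rs3 E1 E3; have := edges_meet C2 C3 pr rs3 E2' E3.
  rewrite ![p == _]eq_sym (negbTE rp3) (negbTE sp3) /= !orbF.
  move=> /orP[] /eqP rE /orP[] /eqP oE.
  - by rewrite rE oE eqxx in ro.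
  - by rewrite edgeC rE oE.
  - by rewrite rE oE.
  - by rewrite rE oE eqxx in ro.
have pr : p != r by rewrite eq_sym.
have or : o != r by rewrite eq_sym.
(* The four excluded cosets are that of [c0] and those of the three sides; they cover 128 of the 256
   codewords. *)
have [c4 Cc4] := @dual_escape C [:: c0; c0 + (b o + b p); c0 + (b p + b r); c0 + (b o + b r)]
  (etrans (congr1 _ NRC.1) (erefl _)).
have edgeE u v : (c0 + (b u + b v) + c4 \notin K) = ~~ edge u v c4.
  by rewrite /edge addrAC addrC.
rewrite /= !edgeE andbT => /and4P[nK4 n1 n2 n3].
have [u [v [uv E4]]] := edge_exists Cc4 nK4.
have := edges_meet Cc4 Cc1 uv op E4 E1; have := edges_meet Cc4 C2 uv pr E4 E2'.
have := edges_meet Cc4 C3 uv or E4 E3'.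
have n1' : ~~ edge p o c4 by rewrite edgeC.
have n2' : ~~ edge r p c4 by rewrite edgeC.
have n3' : ~~ edge r o c4 by rewrite edgeC.
(* An edge meeting all three sides contains two vertices of the triangle, so it would be one of the
   excluded sides. *)
by case/or4P=> /eqP e1; case/or4P=> /eqP e2; case/or4P=> /eqP e3; subst; move: uv;
  rewrite ?eqxx ?E4 // in op pr or n1 n2 n3 n1' n2' n3' *.
Qed.

End CliqueIsStar.

(** * Partitions of [H] and Fano planes *)

Implicit Types (L M : {set 'I_7}).

(** A star with center [o] consists of the cosets of [c0 + b o + b p], so [C] lies in the translate
    of [N] by [c0 + b o]; sizes agree. *)
Lemma NR_translate C : nordstrom_robinson C -> C \subset H ->
  exists2 x, x \in H & C = translate x N.
Proof.
move=> NRC CH; have /card_gt0P[c0 Cc0] : (0 < #|C|)%N by rewrite NRC.1.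
have [o star] := star_center NRC CH Cc0.
exists (c0 + b o); first by rewrite sH.2 ?rep_in ?(subsetP CH).
apply/eqP; rewrite eqEcard card_translate NRC.1 NRN.1 leqnn andbT.
apply/subsetP => c /star[p Kp]; rewrite mem_translate; apply/mem_NP; exists p.
suff -> : b p + (c0 + b o + c) = b o + b p + (c0 + c) by [].
by apply/rowP => i; rewrite !mxE; ring.
Qed.

Lemma line_sub L : line_translate N a L \subset H.
Proof.
apply/subsetP => y; rewrite mem_translate => /(subsetP NH).
by rewrite subgroup_addl ?asum_in.
Qed.

Lemma line_disjoint_code L : #|L| = 3%N -> [disjoint N & line_translate N a L].
Proof.
move=> L3; suff : [disjoint translate 0 N & line_translate N a L] by rewrite translate0.
apply: translate_disjoint; rewrite ?add0r ?sH.1 ?asum_in ?parity_asum ?L3 //.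
by apply/negP => /asum_dual[LE | LE]; move: L3; rewrite LE ?cards0 ?cardsT ?card_ord.
Qed.

Lemma lines_disjoint L M : #|L| = 3%N -> #|M| = 3%N -> #|L :&: M| = 1%N ->
  [disjoint line_translate N a L & line_translate N a M].
Proof.
move=> L3 M3 LM1; have := card_symdiff L M; rewrite L3 M3 LM1.
move=> /eqP; rewrite (_ : 3 + 3 = 4 + 1.*2)%N // eqn_add2r => /eqP D4.
apply: translate_disjoint; rewrite ?asum_in // -!/(asum _) asumD ?parity_asum ?D4 //.
by apply/negP => /asum_dual DE; move: D4; case: DE => ->; rewrite ?cards0 ?cardsT ?card_ord.
Qed.

(** Distinct triples have a symmetric difference of size 6, 4 or 2, and only at size 4 does [q]
    vanish. *)
Lemma disjoint_lines_meet L M : #|L| = 3%N -> #|M| = 3%N -> L != M ->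
  [disjoint line_translate N a L & line_translate N a M] -> #|L :&: M| = 1%N.
Proof.
move=> L3 M3 LM disj; have nq : ~~ q (asum L + asum M).
  by apply: contraTN disj => /translate_meet; apply; apply: asum_in.
have := card_symdiff L M; rewrite L3 M3.
move: nq; rewrite asumD parity_asum.
have lt3 : (#|L :&: M| < 3)%N.
  have le3 : (#|L :&: M| <= #|L|)%N by rewrite subset_leq_card ?subsetIl.
  rewrite L3 in le3; rewrite ltn_neqAle le3 andbT.
  apply: contra LM => /eqP LM3; rewrite eqEcard L3 M3 leqnn andbT.
  by apply/setIidPl/eqP; rewrite eqEcard subsetIl L3 LM3.
by rewrite !inE; move: #|_ :|: _| #|L :&: M| lt3 => m k; lia.
Qed.

Lemma NR_partition_card (P : {set {set F2vec 16}}) : NR_partition P H -> #|P| = 8%N.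
Proof.
move=> [partP NRP]; have P256 : {in P, forall A : {set F2vec 16}, #|A| = (2 ^ 8)%N}.
  by move=> A /NRP[].
have := card_uniform_partition P256 partP; rewrite cardH -[11%N]/(3 + 8)%N expnD.
by move/eqP; rewrite eqn_pmul2r ?expn_gt0 // => /eqP <-.
Qed.

(** The symmetric difference of two triples has even size, so it cannot be all seven points and must
    be empty. *)
Lemma eq_lines L M : #|L| = 3%N -> #|M| = 3%N ->
  line_translate N a L = line_translate N a M -> L = M.
Proof.
move=> L3 M3 /eqP; rewrite eq_translate_Ker Ker_eq_dual -!/(asum _) asumD.
have := card_symdiff L M; rewrite L3 M3 => cD /asum_dual[/eqP | DT].
  by rewrite setU_eq0 !setD_eq0 -eqEsubset => /eqP.
by move: cD; rewrite DT cardsT card_ord; case: #|_ :&: _|.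
Qed.

(** Eight pairwise disjoint subsets of [H] with 256 words each exhaust its [2 ^ 11] words. *)
Lemma fano_NR_partition S : fano_plane S ->
  [/\ NR_partition (fano_parts N a S) H, #|fano_parts N a S| = 8%N
    & H = N :|: \bigcup_(L in S) line_translate N a L].
Proof.
move=> FS; have [S7 S3 _] := FS; set P := fano_parts N a S.
have NnotS : N \notin line_translate N a @: S.
  apply/imsetP => -[L SL NL]; have := line_disjoint_code (S3 L SL).
  by rewrite -NL -setI_eq0 setIid => /eqP N_0; move: N0; rewrite N_0 inE.
have injS : {in S &, injective (line_translate N a)}.
  by move=> L M SL SM; apply: eq_lines; apply: S3.
have P8 : #|P| = 8%N by rewrite cardsU1 NnotS card_in_imset // S7.
have NRP A : A \in P -> nordstrom_robinson A.
  by rewrite !inE => /orP[/eqP -> // | /imsetP[L _ ->]]; apply: translate_NR.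
have trivP : trivIset P.
  apply/trivIsetP => A B; rewrite !inE.
  move=> /orP[/eqP -> | /imsetP[L SL ->]] /orP[/eqP -> | /imsetP[M SM ->]] AB.
  - by rewrite eqxx in AB.
  - exact/line_disjoint_code/S3.
  - by rewrite disjoint_sym; apply/line_disjoint_code/S3.
  - apply: lines_disjoint; [exact: S3 | exact: S3 |]; apply: (fano_meet FS SL SM).
    by apply: contraNneq AB => ->.
have coverP : cover P = N :|: \bigcup_(L in S) line_translate N a L.
  by rewrite /cover big_setU1 // big_imset.
have coverH : cover P = H.
  apply/eqP; rewrite eqEcard coverP subUset NH /=; apply/andP; split.
    by apply/bigcupsP => L _; apply: line_sub.
  rewrite -coverP -(eqP trivP) (eq_bigr (fun=> 2 ^ 8)%N) => [|A /NRP[] //].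
  by rewrite sum_nat_const P8 cardH -(expnD 2 3 8).
split=> //; last by rewrite -coverP.
split=> //; apply/and3P; split=> //; first by rewrite coverH.
by apply/negP => /NRP[]; rewrite cards0.
Qed.

Lemma NR_partition_fano (P : {set {set F2vec 16}}) :
  NR_partition P H -> N \in P ->
  exists2 S : {set {set 'I_7}}, fano_plane S & P = fano_parts N a S.
Proof.
move=> partP PN; have P8 := NR_partition_card partP.
have [/and3P[/eqP coverP trivP _] NRP] := partP.
(* All triples whose translate is a part: disjointness from [N] gives every other part such a
   triple, and [eq_lines] makes it unique. *)
pose S := [set L : {set 'I_7} | (#|L| == 3%N) && (line_translate N a L \in P)].
have S3 L : L \in S -> #|L| = 3%N by rewrite inE => /andP[/eqP].
have SP L : L \in S -> line_translate N a L \in P by rewrite inE => /andP[_].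
have subH C : C \in P -> C \subset H.
  by move=> PC; rewrite -coverP; apply: bigcup_sup.
have PE : P = fano_parts N a S.
  apply/eqP; rewrite eqEsubset; apply/andP; split; last first.
    by rewrite subUset sub1set PN; apply/subsetP => _ /imsetP[L /SP PL ->].
  apply/subsetP => C PC; apply/setU1P.
  have [-> | CN] := eqVneq C N; [by left | right].
  have [x Hx CE] := NR_translate (NRP C PC) (subH C PC).
  have disj : [disjoint translate 0 N & translate x N].
    by rewrite translate0 -CE; apply: (trivIsetP trivP); rewrite // eq_sym.
  have nqx : ~~ q x.
    apply: contraTN disj => qx; apply: translate_meet; rewrite ?sH.1 //.
    by rewrite add0r.
  have nKx : x \notin K.
    by apply: contra CN; rewrite -Ker_eq_dual CE inE.
  have [L [L3 KLx]] := parity0_triple Hx nKx nqx.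
  have CL : C = line_translate N a L.
    by rewrite CE; apply/eqP; rewrite eq_translate_Ker Ker_eq_dual addrC.
  by apply/imsetP; exists L; rewrite // inE L3 -CL PC.
have injS : {in S &, injective (line_translate N a)}.
  by move=> L M SL SM; apply: eq_lines; apply: S3.
exists S => //; apply: fano_of_meet => // [|L M SL SM LM].
  have NnotS : N \notin line_translate N a @: S.
    apply/imsetP => -[L SL NL]; have := line_disjoint_code (S3 L SL).
    by rewrite -NL -setI_eq0 setIid => /eqP N_0; move: N0; rewrite N_0 inE.
  by move: P8; rewrite PE cardsU1 NnotS card_in_imset // => -[].
apply: disjoint_lines_meet => //; [exact: S3 | exact: S3 |].
apply: (trivIsetP trivP); rewrite ?SP //.
by apply: contra LM => /eqP LM; apply/eqP; apply: injS.
Qed.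

End Frame.
End ExtendedHamming.

Theorem mainTheorem1 (N H : {set F2vec 16}) (a : 'I_7 -> F2vec 16)
    (N_NR : nordstrom_robinson N) (N_reduced : reduced N)
    (N_cosets : coset_decomposition N a)
    (H_hamming : extended_hamming16 H) (N_sub_H : N \subset H) :
  (forall S : {set {set 'I_7}}, fano_plane S ->
     [/\ NR_partition (fano_parts N a S) H,
         #|fano_parts N a S| = 8%N
       & H = N :|: \bigcup_(L in S) line_translate N a L]) /\
  (forall P : {set {set F2vec 16}}, NR_partition P H -> N \in P ->
     exists2 S : {set {set 'I_7}}, fano_plane S & P = fano_parts N a S).
Proof.
have [V [HE dimV [dH _]]] := H_hamming.
have sH : subgroup H.
  by rewrite HE; split=> [|x y]; rewrite !inE ?mem0v //; apply: rpredD.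
have cardH : #|H| = (2 ^ 11)%N.
  by rewrite HE cardsE card_vspace dimV card_Fp.
have wtH : {in H, forall x, x != 0 -> (4 <= wt x)%N}.
  by move=> x Hx x0; rewrite -[x]addr0 -hamming_distE dH ?sH.1.
split; first exact: fano_NR_partition.
exact: NR_partition_fano.
Qed.
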